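(* Let $C$ be any unital and semisimple PMV-subalgebra (respectively, unital and semisimple $f$MV-subalgebra) of $C([0,1])$ such that $p_1\in C$, and let $\{m_k\}_{k\ge0}$ be a sequence of real numbers in $[0,1]$. There exists a state $s:C\to[0,1]$ such that $s(p_k)=m_k$ for all $k\ge0$ if and only if the sequence $\{m_k\}_{k\ge 0}$ satisfies the Hausdorff moment condition.
   Context: $C([0,1])$ denotes the set of continuous functions $f:[0,1]\to[0,1]$ with the pointwise operations $f\oplus g=\min(f+g,1)$, $f^*=1-f$, zero element the constant $0$, pointwise product, and (for the $f$MV structure) multiplication by scalars $\alpha\in[0,1]$. A PMV-subalgebra is a subset containing $0$ and closed under $\oplus$, ${}^*$ and product; an $f$MV-subalgebra is moreover closed under multiplication by scalars in $[0,1]$. Unital means that the product has a unit; semisimple means that the intersection of all maximal ideals of the underlying MV-algebra is $\{0\}$. $p_k:[0,1]\to[0,1]$ is $p_k(x)=x^k$ for $k\ge1$, and $p_0(x)=1$. A state on $C$ is a map $s:C\to[0,1]$ with $s(1)=1$ and $s(f+g)=s(f)+s(g)$ whenever $f,g\in C$ and $f\le 1-g$. For a sequence $\{m_k\}_{k\ge0}$ put $\Delta^0m_k=m_k$ and $\Delta^rm_k=\Delta^{r-1}m_{k+1}-\Delta^{r-1}m_k$ for $r\ge1$, $k\ge0$. The sequence satisfies the Hausdorff moment condition if $m_0=1$ and $(-1)^r\Delta^rm_k\ge0$ for all $r,k\ge0$. *)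

(* Defs.v *)
From HB Require Import structures.
From mathcomp Require Import all_boot all_order all_algebra.
From mathcomp Require Import all_classical all_reals all_analysis.

Set Implicit Arguments.
Unset Strict Implicit.
Unset Printing Implicit Defensive.

Import Order.TTheory GRing.Theory Num.Theory.
Import numFieldNormedType.Exports.

Local Open Scope classical_set_scope.
Local Open Scope ring_scope.

Definition I01 (R : realType) : Type := set_type `[0 : R, 1 : R]%classic.
HB.instance Definition _ (R : realType) :=
  PseudoMetric.copy (I01 R) (set_type `[0 : R, 1 : R]%classic).

Coercion I01_val (R : realType) (x : I01 R) : R := \val x.

Definition C01 (R : realType) : Type := continuousType (I01 R) (I01 R).

Definition C01_eval (R : realType) (f : C01 R) (x : I01 R) : R :=
  I01_val ((f : continuousType (I01 R) (I01 R)) x).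
Coercion C01_eval : C01 >-> Funclass.

Section Operations.
Context {R : realType}.
Implicit Types (x : I01 R) (f g : C01 R).

Lemma I01_ge0 x : 0 <= x :> R.
Proof. by have := set_valP x; rewrite /= in_itv /= => /andP[]. Qed.

Lemma I01_le1 x : x <= 1 :> R.
Proof. by have := set_valP x; rewrite /= in_itv /= => /andP[]. Qed.

Lemma I01_inj : injective (@I01_val R).
Proof. exact: val_inj. Qed.

Lemma C01P f g : (forall x, f x = g x) -> f = g.
Proof.
by move=> fg; apply: (proj2 (continuousEP f g)) => x; apply: I01_inj (fg x).
Qed.

Lemma C01_ge0 f x : 0 <= f x.
Proof. exact: I01_ge0. Qed.

Lemma C01_le1 f x : f x <= 1.
Proof. exact: I01_le1. Qed.

Lemma mem_I01 (a : R) : 0 <= a <= 1 -> a \in `[0 : R, 1 : R]%classic.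
Proof. by move=> ?; rewrite inE /= in_itv. Qed.

Definition mkI01 (a : R) (a01 : 0 <= a <= 1) : I01 R := exist _ a (mem_I01 a01).

Lemma I01_continuous : continuous (@I01_val R).
Proof. exact: initial_continuous. Qed.

Lemma C01_continuous f : continuous (f : I01 R -> R).
Proof.
move=> x; apply: (@continuous_comp _ _ _ (Continuous.sort f) (@I01_val R)).
  exact: cts_fun.
exact: I01_continuous.
Qed.

Lemma mkC01_subproof (h : I01 R -> R) (h01 : forall x, 0 <= h x <= 1) :
  continuous h -> continuous (fun x => mkI01 (h01 x)).
Proof. by move=> hc; apply: continuous_comp_initial. Qed.

Definition mkC01 (h : I01 R -> R) (h01 : forall x, 0 <= h x <= 1)
  (hc : continuous h) : C01 R :=
  (mkcts (@mkC01_subproof h h01 hc) : continuousType (I01 R) (I01 R)).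

Lemma C01_zero_01 (x : I01 R) : 0 <= (0 : R) <= 1.
Proof. by rewrite lexx ler01. Qed.

Lemma C01_zero_continuous : continuous (fun _ : I01 R => 0 : R).
Proof. exact: cst_continuous. Qed.

Definition C01_zero : C01 R := mkC01 C01_zero_01 C01_zero_continuous.

Lemma C01_oplus_01 f g x : 0 <= Num.min (f x + g x) 1 <= 1.
Proof. by rewrite le_min ge_min lexx ler01 addr_ge0 ?C01_ge0 ?orbT. Qed.

Lemma C01_oplus_continuous f g :
  continuous (fun x => Num.min (f x + g x) 1).
Proof.
move=> x; apply: (@continuous_min R _ (fun x => f x + g x) (fun=> 1)).
  by apply: continuousD; apply: C01_continuous.
exact: cst_continuous.
Qed.

Definition C01_oplus f g : C01 R :=
  mkC01 (C01_oplus_01 f g) (@C01_oplus_continuous f g).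

Lemma C01_neg_01 f x : 0 <= 1 - f x <= 1.
Proof. by rewrite subr_ge0 C01_le1 gerBl C01_ge0. Qed.

Lemma C01_neg_continuous f : continuous (fun x => 1 - f x).
Proof.
by move=> x; apply: continuousB; [exact: cst_continuous|exact: C01_continuous].
Qed.

Definition C01_neg f : C01 R := mkC01 (C01_neg_01 f) (@C01_neg_continuous f).

Definition C01_one : C01 R := C01_neg C01_zero.

Lemma C01_mul_01 f g x : 0 <= f x * g x <= 1.
Proof. by rewrite mulr_ge0 ?mulr_ile1 ?I01_ge0 ?I01_le1 ?C01_ge0 ?C01_le1. Qed.

Lemma C01_mul_continuous f g : continuous (fun x => f x * g x).
Proof. by move=> x; apply: continuousM; apply: C01_continuous. Qed.

Definition C01_mul f g : C01 R :=
  mkC01 (C01_mul_01 f g) (@C01_mul_continuous f g).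

Lemma C01_scale_01 (a : I01 R) f x : 0 <= (a : R) * f x <= 1.
Proof. by rewrite mulr_ge0 ?mulr_ile1 ?I01_ge0 ?I01_le1 ?C01_ge0 ?C01_le1. Qed.

Lemma C01_scale_continuous (a : I01 R) f : continuous (fun x => (a : R) * f x).
Proof.
move=> x; apply: (@continuousM _ _ (fun=> I01_val a) f).
  exact: cst_continuous.
exact: C01_continuous.
Qed.

Definition C01_scale (a : I01 R) f : C01 R :=
  mkC01 (C01_scale_01 a f) (@C01_scale_continuous a f).

Lemma C01_pow_01 k x : 0 <= (x : R) ^+ k <= 1.
Proof. by rewrite exprn_ge0 ?exprn_ile1 ?I01_ge0 ?I01_le1. Qed.

Lemma C01_pow_continuous k : continuous (fun x => (x : R) ^+ k).
Proof.
move=> x; apply: (@continuous_comp _ _ _ (@I01_val R) (fun y : R => y ^+ k)).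
  exact: I01_continuous.
exact: exprn_continuous.
Qed.

Definition C01_pow k : C01 R := mkC01 (C01_pow_01 k) (@C01_pow_continuous k).

Definition C01_le f g : Prop := forall x, f x <= g x.

Lemma C01_zeroE x : C01_zero x = 0.
Proof. by []. Qed.

Lemma C01_oplusE f g x : C01_oplus f g x = Num.min (f x + g x) 1.
Proof. by []. Qed.

Lemma C01_negE f x : C01_neg f x = 1 - f x.
Proof. by []. Qed.

Lemma C01_oneE x : C01_one x = 1.
Proof. by rewrite C01_negE C01_zeroE subr0. Qed.

Lemma C01_mulE f g x : C01_mul f g x = f x * g x.
Proof. by []. Qed.

Lemma C01_scaleE (a : I01 R) f x : C01_scale a f x = (a : R) * f x.
Proof. by []. Qed.

Lemma C01_powE k x : C01_pow k x = (x : R) ^+ k.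
Proof. by []. Qed.

End Operations.

Record pmv_subalg (R : realType) := PMVSubalg {
  pmv_set :> set (C01 R);
  pmv_zero : pmv_set C01_zero;
  pmv_oplus : forall f g, pmv_set f -> pmv_set g -> pmv_set (C01_oplus f g);
  pmv_neg : forall f, pmv_set f -> pmv_set (C01_neg f);
  pmv_mul : forall f g, pmv_set f -> pmv_set g -> pmv_set (C01_mul f g)
}.

Record fmv_subalg (R : realType) := FMVSubalg {
  fmv_pmv :> pmv_subalg R;
  fmv_scale : forall (a : I01 R) f,
    pmv_set fmv_pmv f -> pmv_set fmv_pmv (C01_scale a f)
}.

Section Subalgebras.
Context {R : realType}.
Variable C : pmv_subalg R.

Definition unital : Prop :=
  exists2 u, pmv_set C u &
    forall f, pmv_set C f -> C01_mul u f = f /\ C01_mul f u = f.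

Definition is_ideal (J : set (C01 R)) : Prop :=
  [/\ J `<=` C,
      J C01_zero,
      forall f g, J f -> J g -> J (C01_oplus f g) &
      forall f g, pmv_set C f -> J g -> C01_le f g -> J f].

Definition is_maximal_ideal (M : set (C01 R)) : Prop :=
  [/\ is_ideal M,
      M <> pmv_set C &
      forall J, is_ideal J -> M `<=` J -> J <> pmv_set C -> J = M].

Definition semisimple : Prop :=
  \bigcap_(M in is_maximal_ideal) M = [set C01_zero].

Lemma pmv_one : pmv_set C C01_one.
Proof. exact: pmv_neg (pmv_zero C). Qed.

Lemma pmv_pow : pmv_set C (C01_pow 1) -> forall k, pmv_set C (C01_pow k).
Proof.
move=> C1; elim=> [|k Ck].
  have -> : C01_pow 0 = C01_one :> C01 R.
    by apply: C01P => x; rewrite C01_powE C01_oneE expr0.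
  exact: pmv_one.
have -> : C01_pow k.+1 = C01_mul (C01_pow 1) (C01_pow k) :> C01 R.
  by apply: C01P => x; rewrite C01_mulE !C01_powE expr1 exprS.
exact: pmv_mul.
Qed.

Definition elt (f : C01 R) (Cf : pmv_set C f) : set_type C :=
  exist _ f (mem_set Cf).

(* The sum [f + g], which lies in [C] when [f <= 1 - g] because it is then
   [C01_oplus f g], is given as an element [h] of [C]. *)
Definition is_state (s : set_type C -> I01 R) : Prop :=
  s (elt pmv_one) = 1 :> R /\
  forall f g h : set_type C,
    C01_le (\val f) (C01_neg (\val g)) ->
    (forall x, \val h x = \val f x + \val g x) ->
    s h = (s f : R) + (s g : R) :> R.

End Subalgebras.

Fixpoint fin_diff {R : realType} (r : nat) (m : nat -> R) (k : nat) : R :=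
  if r is r'.+1 then fin_diff r' m k.+1 - fin_diff r' m k else m k.

Definition hausdorff_moment {R : realType} (m : nat -> R) : Prop :=
  m 0 = 1 /\ forall r k, 0 <= (-1) ^+ r * fin_diff r m k.

(* Main.v *)
Require Import Defs.
From mathcomp Require Import all_boot all_order all_algebra.
From mathcomp Require Import all_classical all_reals all_analysis.
From mathcomp Require Import ring.

Import Order.TTheory GRing.Theory Num.Theory.
Import numFieldNormedType.Exports.
Local Open Scope classical_set_scope.
Local Open Scope ring_scope.

(** Write w(k,r) for (-1)^r Delta^r m_k.  If the m_k are the moments of a state
    s, then w(k,r) is the value of s at x^k (1-x)^r, because both sides obey the
    Pascal relation w(k,r) = w(k+1,r) + w(k,r+1), which for the functions is
    1 = x + (1-x) and for s is additivity ([state_bernstein]).  The products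
    x^k (1-x)^r lie in C, so these numbers are nonnegative.

    Conversely, let the moment condition hold.  For each n the numbers
    binomial(n,k) w(k,n-k), 0 <= k <= n, are nonnegative and have sum m_0 = 1.
    They are the values that the state sought would give to the Bernstein basis
    polynomials of degree n, and placing them as masses at the points k/n gives
    a discrete probability measure, hence a mean L_n(f) in [0,1] for every f.
    The Pascal relation makes the factorial moments of this measure explicit
    ([sum_ffact_hdiff]): the mean of k(k-1)...(k-j+1) is n(n-1)...(n-j+1) m_j.
    Since (k/n)^j differs little from the corresponding factorial quotient, it
    follows that L_n(p_j) tends to m_j ([cvg_discrete_mean_pow]).

    For a general f the numbers L_n(f) stay in the compact interval [0,1], so
    they converge along an ultrafilter finer than the neighbourhoods of infinity
    ([ultra_cvg_compact]); one ultrafilter serves all f at once.  These limits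
    are additive in f and agree with the ordinary limits m_j on the p_j.  They
    form a state on all of C([0,1]), whose restriction to C is the state
    sought. *)

Definition hdiff {R : realType} (m : nat -> R) (k r : nat) : R :=
  (-1) ^+ r * fin_diff r m k.

Lemma hdiff_split {R : realType} (m : nat -> R) k r :
  hdiff m k r = hdiff m k.+1 r + hdiff m k r.+1.
Proof. by rewrite /hdiff /= exprS; ring. Qed.

(** The image of the binomial identity x^a (x + (1-x))^n = x^a under the formal
    functional that takes x^k (1-x)^r to [hdiff m k r]. *)
Lemma sum_bin_hdiff {R : realType} (m : nat -> R) n a :
  \sum_(k < n.+1) 'C(n, k)%:R * hdiff m (a + k) (n - k) = m a.
Proof.
elim: n => [|n IHn].
  by rewrite big_ord1 bin0 addn0 /hdiff /= !mul1r.
rewrite big_ord_recl bin0 subn0 addn0.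
under eq_bigr => i _ do
  rewrite lift0 binS subSS addnS natrD mulrDl.
rewrite big_split /= addrA [X in _ + X + _]big_ord_recr /= bin_small //.
rewrite mul0r addr0.
(* Split each term of the sum for [n] by the Pascal relation of [hdiff], to
   match the splitting of the sum for [n.+1] by the Pascal rule of 'C. *)
rewrite -[X in _ = X]IHn [in RHS](eq_bigr (fun i : 'I_n.+1 =>
  'C(n, i)%:R * hdiff m (a + i) (n - i).+1
  + 'C(n, i)%:R * hdiff m (a + i).+1 (n - i))); last first.
  by move=> i _; rewrite -mulrDr addrC -hdiff_split.
rewrite big_split /=; congr (_ + _).
rewrite [RHS]big_ord_recl bin0 subn0 addn0; congr (_ + _).
by apply: eq_bigr => i _; rewrite lift0 addnS subnSK.
Qed.

(** Factorial moments of the binomial weights: k 'C(n, k) = n 'C(n-1, k-1)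
    absorbs one factor of the falling factorial at a time, and each absorption
    raises the shift [a] by one. *)
Lemma sum_ffact_hdiff {R : realType} (m : nat -> R) j n a :
  \sum_(k < n.+1) (k ^_ j)%:R * ('C(n, k)%:R * hdiff m (a + k) (n - k))
  = (n ^_ j)%:R * m (a + j)%N.
Proof.
elim: j n a => [|j IHj] n a.
  under eq_bigr => k _ do rewrite ffactn0 mul1r.
  by rewrite sum_bin_hdiff ffactn0 mul1r addn0.
case: n => [|n]; first by rewrite big_ord1 /= !ffact0n !mul0r.
rewrite big_ord_recl ffact0n mul0r add0r ffactSS natrM -mulrA -addSnnS.
(* The factor taken out lowers [n] and [j] and moves the shift to [a.+1]. *)
rewrite -IHj mulr_sumr; apply: eq_bigr => k _.
rewrite lift0 ffactSS addnS subSS mulrA -!natrM !mulrA -!natrM.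
by rewrite mulnAC -mul_bin_diag mulnAC.
Qed.

Lemma cvg_div_nat {R : realType} (a : R) :
  (fun n => a / n.+1%:R) @ \oo --> (0 : R).
Proof. by rewrite -(mulr0 a); apply: cvgMr; exact: cvg_harmonic. Qed.

(** Induction on [j], through the exact relation
    n^_(j+1) / n^(j+1) = n^_j / n^j - (j/n) (n^_j / n^j), where [n] stands for
    the successor in the statement. *)
Lemma cvg_ffact_div_expn {R : realType} j :
  (fun n => (n.+1 ^_ j)%:R / n.+1%:R ^+ j : R) @ \oo --> (1 : R).
Proof.
elim: j => [|j IHj].
  by under eq_fun do rewrite ffactn0 expr0 divr1; exact: cvg_cst.
have -> : (fun n => (n.+1 ^_ j.+1)%:R / n.+1%:R ^+ j.+1 : R) =
  (fun n => (n.+1 ^_ j)%:R / n.+1%:R ^+ j -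
            j%:R / n.+1%:R * ((n.+1 ^_ j)%:R / n.+1%:R ^+ j) : R).
  apply/funext => n; rewrite ffactnSr natrM.
  have [jn|nj] := leqP j n.+1; last first.
    by rewrite ffact_small // !mul0r mulr0 subr0.
  rewrite natrB // exprS; field.
  by rewrite expf_neq0 ?nat1r ?pnatr_eq0.
rewrite -[X in _ --> X]subr0 -(mul0r 1).
by apply: cvgB => //; apply: cvgM => //; exact: cvg_div_nat.
Qed.

Definition hausdorff_weight {R : realType} (m : nat -> R) (n k : nat) : R :=
  'C(n, k)%:R * hdiff m k (n - k).

Lemma sum_hausdorff_weight {R : realType} (m : nat -> R) n :
  \sum_(k < n.+1) hausdorff_weight m n k = m 0%N.
Proof. exact: (sum_bin_hdiff m n 0). Qed.

(** Carrying an ordinary power and a factorial quotient together gives an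
    induction that trades one for the other: from k k^_j = k^_(j+1) + j k^_j,
    the moment of type (i+1, j) is the moment of type (i, j+1) plus j/n times
    that of type (i, j), and the latter vanishes in the limit because the moment
    of type (i, j) converges.  At i = 0 the moments are known exactly. *)
Lemma cvg_mixed_moment {R : realType} (m : nat -> R) i j :
  (fun n => \sum_(k < n.+2) (k%:R / n.+1%:R) ^+ i *
     ((k ^_ j)%:R / n.+1%:R ^+ j) * hausdorff_weight m n.+1 k) @ \oo
  --> m (i + j)%N.
Proof.
elim: i j => [|i IHi] j.
  rewrite (_ : (fun n => _) =
    (fun n => (n.+1 ^_ j)%:R / n.+1%:R ^+ j * m j)); last first.
    apply/funext => n; rewrite mulrAC -[X in m X]add0n -sum_ffact_hdiff.
    rewrite mulr_suml; apply: eq_bigr => k _.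
    by rewrite expr0 mul1r mulrAC.
  rewrite add0n -[X in _ --> X]mul1r.
  by apply: cvgMl; exact: cvg_ffact_div_expn.
rewrite (_ : (fun n => _) =
    (fun n => \sum_(k < n.+2) (k%:R / n.+1%:R) ^+ i *
       ((k ^_ j.+1)%:R / n.+1%:R ^+ j.+1) * hausdorff_weight m n.+1 k +
      j%:R / n.+1%:R *
       \sum_(k < n.+2) (k%:R / n.+1%:R) ^+ i *
       ((k ^_ j)%:R / n.+1%:R ^+ j) * hausdorff_weight m n.+1 k)); last first.
  apply/funext => n; rewrite mulr_sumr -big_split /=.
  apply: eq_bigr => k _; rewrite [X in _ + X]mulrA -mulrDl; congr (_ * _).
  rewrite ffactnSr natrM exprS.
  have [jk|kj] := leqP j k; last first.
    by rewrite ffact_small // !mul0r !mulr0 add0r.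
  rewrite natrB // [_ ^+ j.+1]exprS; field.
  by rewrite expf_neq0 ?nat1r ?pnatr_eq0.
rewrite addSnnS.
have -> : m (i + j.+1)%N = m (i + j.+1)%N + 0 * m (i + j)%N.
  by rewrite mul0r addr0.
exact: (cvgD (IHi _) (cvgM (cvg_div_nat _) (IHi _))).
Qed.

Lemma node_01 {R : realType} n (k : 'I_n.+2) :
  0 <= (k%:R / n.+1%:R : R) <= 1.
Proof.
by rewrite divr_ge0 ?ler0n //= ler_pdivrMr ?ltr0n // mul1r ler_nat -ltnS.
Qed.

Definition node {R : realType} n (k : 'I_n.+2) : I01 R := mkI01 (node_01 n k).

(** The sequence starts at the measure on the multiples of 1/(n+1), so that no
    mesh is a division by zero. *)
Definition discrete_mean {R : realType} (m : nat -> R) (n : nat)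
  (f : I01 R -> R) : R :=
  \sum_(k < n.+2) f (node n k) * hausdorff_weight m n.+1 k.

Lemma cvg_discrete_mean_pow {R : realType} (m : nat -> R) i :
  (fun n => discrete_mean m n (C01_pow i)) @ \oo --> m i.
Proof.
rewrite -[in X in _ --> X](addn0 i).
have := @cvg_mixed_moment R m i 0.
under eq_fun do under eq_bigr do rewrite ffactn0 expr0 divr1 mulr1.
exact.
Qed.

Lemma discrete_mean_01 {R : realType} (m : nat -> R) n (f : C01 R) :
  hausdorff_moment m -> 0 <= discrete_mean m n f <= 1.
Proof.
move=> [m0 mpos]; have w_ge0 k : 0 <= hausdorff_weight m n.+1 k.
  by rewrite mulr_ge0 ?ler0n //; exact: mpos.
apply/andP; split.
  by apply: sumr_ge0 => k _; rewrite mulr_ge0 ?C01_ge0.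
rewrite -m0 -(sum_hausdorff_weight m n.+1); apply: ler_sum => k _.
by rewrite ler_piMl ?C01_le1.
Qed.

(** A cluster point [p] of [u] along an ultrafilter is a limit, since each
    preimage of a neighbourhood of [p] or its complement is in the ultrafilter,
    and the complement would contradict clustering. *)
Lemma ultra_cvg_compact (I : Type) (T : topologicalType) (G : set_system I)
    (K : set T) (u : I -> T) :
  UltraFilter G -> compact K -> (forall i, K (u i)) ->
  exists2 p, K p & u @ G --> p.
Proof.
move=> UG Kc Ku.
have [p [Kp clp]] : K `&` cluster (u @ G) !=set0.
  apply: Kc; rewrite /fmap /=.
  by apply: filterS (@filterT _ G _) => i _; exact: Ku.
exists p => // V pV; have [//|GV] := in_ultra_setVsetC (u @^-1` V) UG.
have [x [nVx Vx]] := clp (~` V) V GV pV.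
by case: (nVx Vx).
Qed.

(** The state is the limit of the discrete means along an ultrafilter finer than
    convergence to infinity: a limit exists for each function by compactness of
    [0, 1], and uniqueness of limits gives additivity and the values at powers. *)
Lemma hausdorff_moment_state {R : realType} (C : pmv_subalg R)
    (Cp : forall k, pmv_set C (C01_pow k)) (m : nat -> R) :
  hausdorff_moment m ->
  exists s : set_type C -> I01 R,
    is_state s /\ forall k, s (elt (Cp k)) = m k :> R.
Proof.
move=> Hm; have [G [UG subG]] := @ultraFilterLemma nat \oo _.
have lim_ex (f : C01 R) : exists l : I01 R,
    (fun n => discrete_mean m n f) @ G --> (l : R).
  have [||l l01 cvl] := @ultra_cvg_compact nat R G `[0, 1]%classic
    (fun n => discrete_mean m n f) UG.
  - exact: segment_compact.
  - by move=> n /=; rewrite in_itv /=; exact: discrete_mean_01.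
  by exists (exist _ l (mem_set l01)).
have [S cvS] := choice lim_ex.
have S_eq (f : C01 R) (l : R) :
    (fun n => discrete_mean m n f) @ G --> l -> S f = l :> R.
  by move=> cvl; apply: (cvg_unique _ (cvS f) cvl).
have S_pow k : S (C01_pow k) = m k :> R.
  by apply: S_eq; apply: cvg_trans (cvg_discrete_mean_pow m k) => A; exact: subG.
exists (fun f => S (\val f)); split=> [|k]; last exact: S_pow.
split=> [|f g h _ hE].
  rewrite /= (_ : C01_one = C01_pow 0); first by rewrite S_pow; case: Hm.
  by apply: C01P => x; rewrite C01_oneE C01_powE expr0.
apply: S_eq; rewrite (_ : (fun n => _) = (fun n =>
    discrete_mean m n (\val f) + discrete_mean m n (\val g))).
  by apply: cvgD; exact: cvS.
apply/funext => n; rewrite -big_split; apply: eq_bigr => k _.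
by rewrite hE mulrDl.
Qed.

(** The function x^k (1-x)^r, built from the operations that a PMV-subalgebra is
    closed under. *)
Definition bernstein {R : realType} (k r : nat) : C01 R :=
  iter r (C01_mul (C01_neg (C01_pow 1))) (C01_pow k).

Lemma bernsteinE {R : realType} k r (x : I01 R) :
  bernstein k r x = (1 - (x : R)) ^+ r * (x : R) ^+ k.
Proof.
elim: r => [|r IHr]; first by rewrite expr0 mul1r.
by rewrite [LHS]/= C01_mulE IHr C01_negE C01_powE expr1 exprS mulrA.
Qed.

Lemma pmv_bernstein {R : realType} (C : pmv_subalg R) k r :
  pmv_set C (C01_pow 1) -> pmv_set C (bernstein k r).
Proof.
move=> Cp1; elim: r => [|r IHr] /=; first exact: pmv_pow.
by apply: pmv_mul => //; exact: pmv_neg.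
Qed.

(** Induction on [r]: x^k (1-x)^r = x^(k+1) (1-x)^r + x^k (1-x)^(r+1), and the
    state is additive on this sum because its terms add up to at most 1. *)
Lemma state_bernstein {R : realType} (C : pmv_subalg R)
    (Cp1 : pmv_set C (C01_pow 1)) (s : set_type C -> I01 R) (m : nat -> R) :
  is_state s -> (forall k, s (elt (pmv_pow Cp1 k)) = m k :> R) ->
  forall r k, s (elt (pmv_bernstein C k r Cp1)) = hdiff m k r :> R.
Proof.
move=> [_ sD] sp; elim=> [|r IHr] k.
  rewrite /hdiff expr0 mul1r /= -sp; congr (I01_val (s _)).
  exact: val_inj.
have split_x (x : I01 R) :
    bernstein k r x = bernstein k.+1 r x + bernstein k r.+1 x.
  by rewrite !bernsteinE !exprS; ring.
have := sD (elt (pmv_bernstein C k.+1 r Cp1)) (elt (pmv_bernstein C k r.+1 Cp1))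
  (elt (pmv_bernstein C k r Cp1)) _ split_x.
rewrite !IHr hdiff_split => /(_ _)/addrI <- // x.
by rewrite C01_negE lerBrDr -split_x C01_le1.
Qed.

Lemma state_hausdorff_moment {R : realType} (C : pmv_subalg R)
    (Cp1 : pmv_set C (C01_pow 1)) (s : set_type C -> I01 R) (m : nat -> R) :
  is_state s -> (forall k, s (elt (pmv_pow Cp1 k)) = m k :> R) ->
  hausdorff_moment m.
Proof.
move=> st sp; split=> [|r k]; last first.
  by rewrite -/(hdiff m k r) -(state_bernstein _ _ _ _ st sp); exact: I01_ge0.
rewrite -sp; case: st => <- _; congr (I01_val (s _)); apply: val_inj.
by apply: C01P => x; rewrite C01_powE C01_oneE expr0.
Qed.

Theorem theorem2p3 (R : realType) :
  (forall (C : pmv_subalg R) (hunital : unital C) (hsemisimple : semisimple C)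
      (hp1 : pmv_set C (C01_pow 1)) (m : nat -> R)
      (hm : forall k, 0 <= m k <= 1),
    (exists s : set_type C -> I01 R,
       is_state s /\ forall k, s (elt (pmv_pow hp1 k)) = m k :> R)
    <-> hausdorff_moment m)
  /\
  (forall (C : fmv_subalg R) (hunital : unital C) (hsemisimple : semisimple C)
      (hp1 : pmv_set C (C01_pow 1)) (m : nat -> R)
      (hm : forall k, 0 <= m k <= 1),
    (exists s : set_type C -> I01 R,
       is_state s /\ forall k, s (elt (pmv_pow hp1 k)) = m k :> R)
    <-> hausdorff_moment m).
Proof.
have pmv_case (C : pmv_subalg R) (Cp1 : pmv_set C (C01_pow 1)) m :
    (exists s : set_type C -> I01 R,
       is_state s /\ forall k, s (elt (pmv_pow Cp1 k)) = m k :> R)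
    <-> hausdorff_moment m.
  split=> [[s [st sp]]|Hm]; first exact: state_hausdorff_moment st sp.
  exact: hausdorff_moment_state.
by split=> C _ _ Cp1 m _; exact: pmv_case.
Qed.
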